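(* Let $d\ge 1$ be an integer. There exist a function $u:\mathbb{Z}^d\to\mathbb{Z}_2$, not identically zero, which is harmonic, i.e. $\sum_{i=1}^d\big(u(x+e_i)+u(x-e_i)\big)=0$ in $\mathbb{Z}_2$ for every $x\in\mathbb{Z}^d$, and a constant $C=C(d)$ such that for every positive integer $n$ no ball of radius $n$ (with arbitrary center) contains more than $Cn^{\log_2(2d)}$ points of $\operatorname{supp}u$.
   Context: $e_1,\dots,e_d$ are the standard basis vectors of $\mathbb{Z}^d$, $\mathbb{Z}_2=\mathbb{Z}/2\mathbb{Z}$, and $\operatorname{supp}u=\{x\in\mathbb{Z}^d: u(x)\ne 0\}$. A $\mathbb{Z}_2$-valued function is called harmonic if at each point the sum of its values over the $2d$ neighbors is $0$ in $\mathbb{Z}_2$ (the term $2d\,u(x)$ of the discrete Laplacian vanishes modulo 2); equivalently, every point of $\mathbb{Z}^d$ has an even number of neighbors in $\operatorname{supp}u$. Balls may be taken with respect to any fixed norm, e.g. the maximum norm (changing the norm only changes $C$). *)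

(* Defs.v *)
From mathcomp Require Import all_boot all_order all_algebra.
From mathcomp Require Import all_classical all_reals all_analysis.

Set Implicit Arguments.
Unset Strict Implicit.
Unset Printing Implicit Defensive.

Import Order.TTheory GRing.Theory Num.Theory.

Local Open Scope classical_set_scope.
Local Open Scope ring_scope.

Definition std_basis (d : nat) (i : 'I_d) : 'rV[int]_d := delta_mx 0 i.

(* The term [2d * u x] of the discrete Laplacian is zero in 'Z_2. *)
Definition harmonic_mod2 (d : nat) (u : 'rV[int]_d -> 'Z_2) : Prop :=
  forall x : 'rV[int]_d,
    \sum_(i < d) (u (x + std_basis i) + u (x - std_basis i)) = 0.

Definition supp (d : nat) (u : 'rV[int]_d -> 'Z_2) : set 'rV[int]_d :=
  [set x | u x != 0].

(* `|_| is the maximum norm on row vectors. *)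
Definition lattice_ball (d : nat) (x : 'rV[int]_d) (n : nat) : set 'rV[int]_d :=
  [set y | `|y - x| <= n%:Z].

Definition log2 (R : realType) (a : R) : R := ln a / ln 2.

(* Main.v *)
Require Import Defs.
From mathcomp Require Import all_boot all_order all_algebra.
From mathcomp Require Import all_classical all_reals all_analysis.
From mathcomp Require Import finmap zify.

Set Implicit Arguments.
Unset Strict Implicit.
Unset Printing Implicit Defensive.

Import Order.TTheory GRing.Theory Num.Theory.

Local Open Scope classical_set_scope.
Local Open Scope ring_scope.

(** Let P be the sum of the 2d translations by the vectors +-e_i, acting on
    functions from Z^d to Z_2, so that u is harmonic when P u = 0.

    In characteristic 2, squaring P doubles the translation vectors
    ([shift_sum_frobenius]), hence P^(2^k) is the sum of the translations by
    +-2^k e_i.  Put a_k = P^(2^k - 1) delta_0 ([green]), where delta_0 is the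
    indicator of the origin.  Then P a_k is supported on the 2d points
    +-2^k e_i, so a_k is harmonic on a large box.  As
    2^k - 1 = 1 + 2 + ... + 2^(k-1), every point of the support of a_k has the
    form sum_(j < k) +-2^j e_(i_j) ([approx_neq0]); such points lie in the box
    of radius 2^k - 1.

    The a_k stabilise on growing boxes: in
    a_(k+2)(x) = sum_(p, q) a_k(x - 2^(k+1) p - 2^k q), with p and q unit
    steps, the argument leaves the support of a_k when x is in the box of
    radius 2^k and q is not -p, and q = -p gives the terms of a_(k+1)(x)
    ([green_stable]).  The pointwise limit u is therefore harmonic everywhere,
    and u(e_1) = a_1(e_1) = 1.

    Sparsity comes from self-similarity.  Fix m with 2^m <= n < 2^(m+1).  In a
    sum of +-2^j e_(i_j), the terms with j >= m add up to a vector of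
    2^m Z^d, and those with j < m to one of at most (2d)^m vectors s of norm
    less than 2^m ([step_sums_coarse]).  For s + 2^m y to lie in a given ball of
    radius n, each coordinate of y must be one of at most 6 consecutive values
    that do not depend on s, so the ball contains at most
    6^d (2d)^m points of the support ([ball_coverP]), and
    (2d)^m = (2^m)^(log2 (2d)) <= n^(log2 (2d)) ([expn_le_powR_log2]). *)

(** * Sums of translates in characteristic 2 *)

Lemma addrr_Z2 (a : 'Z_2) : a + a = 0.
Proof. by rewrite -mulr2n -mulr_natr pchar_Zp ?mulr0. Qed.

(** The off-diagonal terms cancel in pairs; this is the additivity of the
    Frobenius map, in the form needed for sums of commuting translations. *)
Lemma sum_symmetric_Z2 (T : Type) (r : seq T) (g : T -> T -> 'Z_2) :
    (forall p q, g p q = g q p) ->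
  \sum_(p <- r) \sum_(q <- r) g p q = \sum_(p <- r) g p p.
Proof.
move=> gC; elim: r => [|a r IHr]; first by rewrite !big_nil.
rewrite !big_cons -addrA; congr (_ + _).
under [X in _ + X]eq_bigr => p _ do rewrite big_cons gC.
by rewrite big_split IHr addrA addrr_Z2 add0r.
Qed.

Section ShiftSums.

Variables (V : zmodType) (D : finType) (v : D -> V).

Definition shift_sum (s : nat) (f : V -> 'Z_2) : V -> 'Z_2 :=
  fun x => \sum_p f (x - v p *+ s).

Definition point_mass : V -> 'Z_2 := fun x => (x == 0)%:R.

Lemma eq_shift_sum s f g : f =1 g -> shift_sum s f =1 shift_sum s g.
Proof. by move=> fg x; apply: eq_bigr => p _; rewrite fg. Qed.

Lemma shift_sumC s t f :
  shift_sum s (shift_sum t f) =1 shift_sum t (shift_sum s f).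
Proof.
move=> x; rewrite /shift_sum exchange_big.
by apply: eq_bigr => p _; apply: eq_bigr => q _; rewrite addrAC.
Qed.

(** The square of a sum of translations is the sum of their squares. *)
Lemma shift_sum_frobenius s f :
  shift_sum s (shift_sum s f) =1 shift_sum (2 * s) f.
Proof.
move=> x; rewrite /shift_sum sum_symmetric_Z2 => [|p q].
  by apply: eq_bigr => p _; rewrite mul2n -addnn mulrnDr opprD addrA.
by rewrite addrAC.
Qed.

(** This is P^(2^k - 1) applied to the point mass, P being [shift_sum v 1]:
    the factor P^(2^k') is replaced by the sum of translations which it equals
    by [shift_sum_frobenius]. *)
Fixpoint approx (k : nat) : V -> 'Z_2 :=
  if k is k'.+1 then shift_sum (2 ^ k') (approx k') else point_mass.

(** P * P^(2^k - 1) = P^(2^k): the failure of harmonicity is pushed out to the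
    points [v p *+ 2 ^ k]. *)
Lemma shift_sum_approx k :
  shift_sum 1 (approx k) =1 shift_sum (2 ^ k) point_mass.
Proof.
elim: k => [|k IHk] x //=.
by rewrite shift_sumC (eq_shift_sum _ IHk) shift_sum_frobenius -expnS.
Qed.

Fixpoint step_sums (k : nat) : seq V :=
  if k is k'.+1 then [seq s + v p *+ 2 ^ k' | s <- step_sums k', p <- enum D]
  else [:: 0].

Lemma size_step_sums k : size (step_sums k) = (#|D| ^ k)%N.
Proof. by elim: k => //= k IHk; rewrite size_allpairs IHk -cardT expnSr. Qed.

Lemma shift_sum_neq0 s f x :
  shift_sum s f x != 0 -> exists p, f (x - v p *+ s) != 0.
Proof.
move=> nz; apply/existsP; apply: contraNT nz => /existsPn f0.
by apply/eqP/big1 => p _; apply/eqP; rewrite -[_ == _]negbK f0.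
Qed.

(** Only an inclusion holds: a point reached by an even number of choices of
    steps drops out of the support. *)
Lemma approx_neq0 k x : approx k x != 0 -> x \in step_sums k.
Proof.
elim: k x => [|k IHk] x /=.
  by rewrite /point_mass inE; case: (x == 0).
move=> /shift_sum_neq0[p /IHk sx]; apply/allpairsP.
by exists (x - v p *+ 2 ^ k, p); rewrite sx mem_enum subrK.
Qed.

(** The steps of length at least 2^m contribute a multiple of 2^m; this is the
    self-similarity that makes the support sparse at every scale. *)
Lemma step_sums_coarse m k t : (m <= k)%N -> t \in step_sums k ->
  exists2 s, s \in step_sums m & exists y, t = s + y *+ 2 ^ m.
Proof.
move=> /subnK<-; elim: (k - m)%N t => [|j IHj] t.
  by rewrite add0n => st; exists t => //; exists 0; rewrite mul0rn addr0.
rewrite addSn => /allpairsP[[s p] /= [/IHj[s' s's [y ->]] _ ->]].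
exists s' => //; exists (y + v p *+ 2 ^ j).
by rewrite mulrnDl -mulrnA -expnD addrA.
Qed.

End ShiftSums.

(** * The harmonic function on the lattice *)

Section Lattice.

Variable d : nat.
Implicit Types (x y : 'rV[int]_d) (p q : 'I_d * bool).

Definition unit_step p : 'rV[int]_d :=
  if p.2 then std_basis p.1 else - std_basis p.1.

Definition in_box (n : nat) x := forall j, (`|x 0%R j| <= n)%N.

Definition green k := approx unit_step k.

Lemma unit_stepE p j :
  unit_step p 0 j = if p.1 == j then (if p.2 then 1 else -1) else 0.
Proof.
by case: p => i [] /=; rewrite /unit_step /= !mxE eqxx eq_sym; case: eqP.
Qed.

Lemma unit_stepN i b : unit_step (i, ~~ b) = - unit_step (i, b).
Proof. by case: b; rewrite /unit_step /= ?opprK. Qed.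

Lemma step_sums_box k x : x \in step_sums unit_step k -> in_box (2 ^ k).-1 x.
Proof.
elim: k x => [|k IHk] x /=.
  by rewrite inE => /eqP-> j; rewrite mxE.
move=> /allpairsP[[s p] /= [/IHk sb _ ->]] j.
have := sb j; rewrite mxE mulmxnE unit_stepE expnS.
have : (0 < 2 ^ k)%N by rewrite expn_gt0.
by case: eqP => _; case: p.2 => /=; lia.
Qed.

(** Expand two levels.  With p = +-e_i the larger step, the i-th coordinate of
    2^(k+1) p + 2^k q is at least 2^(k+1) in absolute value unless q = - p, so
    subtracting it from x, whose coordinates are at most 2^k, gives a point
    outside the box of radius 2^k - 1, which contains the support of
    [green k]. *)
Lemma green_stable k x : in_box (2 ^ k) x -> green k.+2 x = green k.+1 x.
Proof.
move=> xb; rewrite /green [LHS]/= [RHS]/=; apply: eq_bigr => -[i b] _.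
rewrite /shift_sum (bigD1 (i, ~~ b)) //= big1 ?addr0.
  rewrite unit_stepN mulNrn opprK expnS mul2n -addnn mulrnDr opprD addrA.
  by rewrite subrK.
move=> q qi; apply/eqP; apply: contraNT qi.
move=> /approx_neq0/step_sums_box/(_ i).
rewrite !(mxE, mulmxnE) !unit_stepE /= eqxx expnS; have := xb i.
have : (0 < 2 ^ k)%N by rewrite expn_gt0.
case: q => i' b' /=; rewrite xpair_eqE.
by case: b; case: b'; case: (i' == i) => /=; lia.
Qed.

Lemma green_stable_le k m x : in_box (2 ^ k) x -> (k <= m)%N ->
  green m.+1 x = green k.+1 x.
Proof.
move=> xb /subnK<-; elim: (m - k)%N => // j IHj.
rewrite addSn green_stable // => i; apply: leq_trans (xb i) _.
by rewrite leq_exp2l ?leq_addl.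
Qed.

Definition l1_norm x := (\sum_j `|x 0%R j|)%N.

(** The pointwise limit of [green k]: the index [(l1_norm x).+1] is one from
    which on the values at x are constant, because l <= 2^l. *)
Definition sparse_harmonic x := green (l1_norm x).+1 x.

Lemma in_box_l1_norm x : in_box (l1_norm x) x.
Proof. by move=> j; rewrite /l1_norm (bigD1 j) //= leq_addr. Qed.

Lemma in_box_le m n x : (m <= n)%N -> in_box m x -> in_box n x.
Proof. by move=> mn xb j; apply: leq_trans mn. Qed.

Lemma sparse_harmonicE k x :
  in_box (2 ^ k) x -> sparse_harmonic x = green k.+1 x.
Proof.
move=> xb; have xl : in_box (2 ^ l1_norm x) x.
  by apply: in_box_le (in_box_l1_norm x); rewrite ltnW // ltn_expl.
rewrite /sparse_harmonic; case: (leqP k (l1_norm x)) => [kl|/ltnW lk].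
  exact: green_stable_le xb kl.
by rewrite (green_stable_le xl lk).
Qed.

Lemma shift_sum_steps (f : 'rV[int]_d -> 'Z_2) x :
  \sum_i (f (x + std_basis i) + f (x - std_basis i)) =
  shift_sum unit_step 1 f x.
Proof.
rewrite /shift_sum -(pair_bigA _ (fun i b => f (x - unit_step (i, b) *+ 1))).
by apply: eq_bigr => i _; rewrite big_bool /unit_step /= opprK addrC.
Qed.

(** Around x the limit coincides with one [green k.+1], whose defects of
    harmonicity, at distance 2^(k+1) from the origin, are beyond x. *)
Lemma harmonic_sparse_harmonic : harmonic_mod2 sparse_harmonic.
Proof.
move=> x; rewrite shift_sum_steps; set k := (l1_norm x).+1.
have k_lt : (k < 2 ^ k)%N by rewrite ltn_expl.
have -> : shift_sum unit_step 1 sparse_harmonic x =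
          shift_sum unit_step 1 (green k.+1) x.
  apply: eq_bigr => p _; apply: sparse_harmonicE => j.
  have := in_box_l1_norm x j; rewrite !mxE unit_stepE.
  by case: eqP => _; case: p.2 => /=; lia.
rewrite shift_sum_approx /shift_sum big1 // => p _; rewrite /point_mass.
case: eqP => // /rowP/(_ p.1).
rewrite !(mxE, mulmxnE) unit_stepE eqxx expnS.
by have := in_box_l1_norm x p.1; case: p.2 => /=; lia.
Qed.

Lemma sparse_harmonic_std_basis i : sparse_harmonic (std_basis i) = 1.
Proof.
rewrite (@sparse_harmonicE 0); last first.
  by move=> j; rewrite /std_basis mxE eqxx /=; case: (j == i).
rewrite /green /= /shift_sum (bigD1 (i, true)) //= big1 => [|p pi].
  by rewrite /point_mass /unit_step /= mulr1n subrr eqxx addr0.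
rewrite /point_mass; case: eqP => // /rowP/(_ i).
rewrite !mxE unit_stepE !eqxx.
by case: p pi => i' []; rewrite xpair_eqE /= ?andbT ?andbF; case: eqP.
Qed.

(** * Sparsity of the support *)

(** A cell of the grid 2^m Z^d is given by its offset, between -2 and 3 in each
    coordinate, from the cell that contains z. *)
Definition ball_cover m (z : 'rV[int]_d) : seq 'rV[int]_d :=
  [seq s + (\row_j ((z 0%R j %/ (2 ^ m)%N)%Z + (w j)%:Z - 2)) *+ 2 ^ m
     | s : 'rV[int]_d <- step_sums unit_step m,
       w : {ffun 'I_d -> 'I_6} <- enum {ffun 'I_d -> 'I_6}].

Lemma size_ball_cover m z : size (ball_cover m z) = ((2 * d) ^ m * 6 ^ d)%N.
Proof.
rewrite size_allpairs size_step_sums -cardT card_ffun !card_ord card_prod.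
by rewrite card_ord card_bool (mulnC d).
Qed.

(** In each coordinate, |s + 2^m y - z| <= n < 2^(m+1) and |s| < 2^m give
    |2^m y - z| < 3 * 2^m; writing z = 2^m q + r with 0 <= r < 2^m yields
    -3 < y - q < 4. *)
Lemma ball_coverP m n z x : (n < 2 ^ m.+1)%N -> in_box n (x - z) ->
  sparse_harmonic x != 0 -> x \in ball_cover m z.
Proof.
move=> nm xz; set k := maxn (l1_norm x) m.
(* An index at least m, so that the steps split into short and long ones. *)
rewrite (@sparse_harmonicE k); last first.
  apply: in_box_le (in_box_l1_norm x).
  by rewrite (leq_trans (leq_maxl _ m)) // ltnW // ltn_expl.
move=> /approx_neq0/(@step_sums_coarse _ _ _ m _ _)[].
  by rewrite (leq_trans (leq_maxr (l1_norm x) _)).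
move=> s sm [y xE]; have sb := step_sums_box sm.
pose w := [ffun j => inord `|y 0 j - (z 0%R j %/ (2 ^ m)%N)%Z + 2| : 'I_6].
apply/allpairsP; exists (s, w); rewrite mem_enum; split => //.
rewrite {1}xE; congr (_ + _ *+ _); apply/rowP => j; rewrite mxE ffunE /=.
have := xz j; rewrite xE !(mxE, mulmxnE); have := sb j; move: nm.
rewrite -mulr_natr natz.
have M0 : (0 < 2 ^ m)%N by rewrite expn_gt0.
have rM : (z 0%R j %% (2 ^ m)%N)%Z < (2 ^ m)%N by apply: ltz_pmod.
have r0 : 0 <= (z 0%R j %% (2 ^ m)%N)%Z by apply: modz_ge0; lia.
have := divz_eq (z 0 j) (2 ^ m)%N; move: M0 r0 rM; rewrite expnS.
move: (_ %/ _)%Z (_ %% _)%Z => q r.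
move: (z 0 j) (y 0 j) (s 0 j) (2 ^ m)%N => zj yj sj M M0 r0 rM zE nM sM xzM.
have lo : -3 < yj - q by nia.
have hi : yj - q < 4 by nia.
by rewrite inordK; lia.
Qed.

Lemma lattice_ball_in_box n z x : lattice_ball z n x -> in_box n (x - z).
Proof.
move=> + j; rewrite /lattice_ball /= => xz.
rewrite -lez_nat abszE; apply: le_trans xz.
rewrite [leRHS]/Num.norm /= mx_normrE.
by apply/bigmax_geP; right; exists (0, j).
Qed.

End Lattice.

(** * Comparison with the real power *)

Lemma counting_le_size (R : realType) (T : choiceType) (A : set T) (r : seq T) :
  A `<=` [set` r] -> (counting A <= (size r)%:R%:E :> \bar R)%E.
Proof.
move=> Ar; have finA : finite_set A by apply: sub_finite_set Ar (finite_seq r).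
rewrite /counting asboolT // lee_fin ler_nat.
apply: uniq_leq_size (fset_uniq _) _ => x.
by rewrite in_fset_set // => /set_mem/Ar.
Qed.

Lemma powR_log2 (R : realType) (a : R) : 0 < a -> 2 `^ log2 a = a.
Proof.
move=> a0; rewrite /log2 /powR pnatr_eq0 /= divfK ?lnK //.
by rewrite gt_eqF // ln_gt0 // ltr1n.
Qed.

Lemma expn_le_powR_log2 (R : realType) (a m n : nat) :
  (0 < a)%N -> (2 ^ m <= n)%N ->
  (a ^ m)%N%:R <= n%:R `^ log2 a%:R :> R.
Proof.
move=> a0 mn.
have L0 : 0 <= log2 (a%:R : R).
  by rewrite /log2 divr_ge0 // ln_ge0 // ler1n.
rewrite natrX -[X in X ^+ _]powR_log2 ?ltr0n // -powR_mulrn ?powR_ge0 //.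
rewrite -powRrM mulrC powRrM powR_mulrn // -natrX.
by apply: ge0_ler_powR; rewrite ?nnegrE ?ler0n ?ler_nat.
Qed.

Theorem theorem2p1 (R : realType) (d : nat) (hd : (1 <= d)%N) :
  exists (u : 'rV[int]_d -> 'Z_2) (C : R),
    (exists x : 'rV[int]_d, u x != 0) /\
    harmonic_mod2 u /\
    (forall (n : nat) (x : 'rV[int]_d), (0 < n)%N ->
      (counting (lattice_ball x n `&` supp u)
         <= (C * n%:R `^ log2 (2 * d)%:R)%R%:E)%E).
Proof.
exists (@sparse_harmonic d), (6 ^ d)%N%:R; split; [|split].
- by exists (std_basis (Ordinal hd)); rewrite sparse_harmonic_std_basis.
- exact: harmonic_sparse_harmonic.
move=> n z n0; pose m := trunc_log 2 n.
have /andP[mn nm] := trunc_log_bounds (isT : (1 < 2)%N) n0.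
have cover : lattice_ball z n `&` supp (@sparse_harmonic d)
             `<=` [set` ball_cover m z].
  by move=> x [/lattice_ball_in_box xz nz]; apply: ball_coverP nm xz nz.
apply: le_trans (counting_le_size _ cover) _.
rewrite lee_fin size_ball_cover natrM mulrC ler_wpM2l ?ler0n //.
by apply: expn_le_powR_log2 => //; rewrite muln_gt0.
Qed.
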